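(* Let $b=p_1^{\alpha_1}\cdots p_k^{\alpha_k}$ be the prime factorization of an integer $b>1$ (distinct primes $p_j$, $\alpha_j\ge 1$), and let $\mathcal D$ be a tile digit set of $b$. Then for each $j\in\{1,\dots,k\}$ and each $0\leq \ell\leq \alpha_j-1$ there exists a unique integer $a_{j,\ell}\equiv \ell \pmod{\alpha_j}$ such that $\Phi_{p_j^{a_{j,\ell}}}(x)$ divides $P_{\mathcal D}(x)$, and the prime-power spectrum of $\mathcal D$ is $$S_{\mathcal D}=\bigcup_{j=1}^k\{p_j^{a_{j,0}},\dots,p_j^{a_{j,\alpha_j-1}}\}.$$
   Context: Let $b>1$ be an integer. A digit set is a finite set $\mathcal D\subset\mathbb{Z}_{\ge 0}$. For such $\mathcal D$, $T(b,\mathcal D)=\{\sum_{k=1}^\infty b^{-k}d_k: d_k\in\mathcal D\}$ is the unique nonempty compact set with $bT=T+\mathcal D$. $\mathcal D$ is called a tile digit set of $b$ if $\#\mathcal D=b$ and $T(b,\mathcal D)$ has nonempty interior (equivalently positive Lebesgue measure; it is then a translational tile of $\mathbb R$). The mask polynomial is $P_{\mathcal D}(x)=\sum_{d\in\mathcal D}x^d$. $\Phi_n$ denotes the $n$-th cyclotomic polynomial. The prime-power spectrum of $\mathcal D$ is $S_{\mathcal D}=\{p^\alpha>1: p \text{ prime},\ \Phi_{p^\alpha}(x)\mid P_{\mathcal D}(x)\}$. *)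

(* Defs.v *)
From HB Require Import structures.
From mathcomp Require Import all_boot all_order all_algebra.
From mathcomp Require Import cyclotomic.
From mathcomp Require Import finmap.
From mathcomp Require Import all_classical all_reals all_analysis.

Set Implicit Arguments.
Unset Strict Implicit.
Unset Printing Implicit Defensive.

Import Order.TTheory GRing.Theory Num.Theory.
Import numFieldNormedType.Exports.

Local Open Scope classical_set_scope.
Local Open Scope ring_scope.

(* The digit d_k (k >= 1) of the expansion is [d k.-1]: the k-th term of the
   series below, counted from 0, is b^{-(k+1)} d_{k+1}. *)
Definition digit_attractor (R : realType) (b : nat) (D : {fset nat}) : set R :=
  [set x | exists d : nat -> nat,
     (forall k, d k \in D) /\
     series (fun k => b%:R ^- k.+1 * (d k)%:R : R) @ \oo --> x].

Definition tile_digit_set (R : realType) (b : nat) (D : {fset nat}) : Prop :=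
  #|` D|%fset = b /\ interior (digit_attractor b D : set R) !=set0.

Definition mask_poly (D : {fset nat}) : {poly int} := \sum_(d <- D) 'X^d.

(* [%|] on [{poly int}] is pseudo-divisibility in general; for the monic
   divisors 'Phi_n it is divisibility in Z[x], see [dvd_CyclotomicP]. *)
Definition prime_power_spectrum (D : {fset nat}) : set nat :=
  [set q | exists p e : nat,
     [/\ prime p, q = (p ^ e)%N, (1 < q)%N & 'Phi_q %| mask_poly D]].

Lemma dvd_CyclotomicP (n : nat) (P : {poly int}) :
  reflect (exists Q, P = Q * 'Phi_n) ('Phi_n %| P).
Proof.
apply: (iffP idP) => [dvdP|[Q ->]]; last exact: dvdp_mulIr.
exists (P %/ 'Phi_n); rewrite Pdiv.IdomainUnit.divpK //.
by rewrite (monicP (Cyclotomic_monic n)) unitr1.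
Qed.

(* Main.v *)
(** Write [P] for the mask polynomial of [D] and [e(x) = exp(2 i pi x)].

    The attractor [T] satisfies [b T = T + D], so if it has interior, comparing
    [T] with its copies of size [b^-n] shows that there are at least a constant
    times [b^n] distinct sums [d_0 + b d_1 + ... + b^(n-1) d_(n-1)], and these
    sums, being [b^n] in number, must then all be distinct.  The exponential
    sum they form at [e(m / b^n)] is [prod_(k <= n) P(e(m / b^k))], and by
    Parseval modulo [b^n] the squares of its values for [0 <= m < b^n], divided
    by [b^(2n)], add up to a bounded quantity.  For [m > 0] the frequencies
    [m], [m b], [m b^2], ... all contribute a partial product of
    [prod_k P(e(m / b^k)) / b], so this product is 0; since its tail is close
    to 1, some factor vanishes (Kenyon's criterion), that is, [Phi_N] divides
    [P] for [N] the reduced denominator of some [m / b^k].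

    With [m] the product of [p^s] and a large power of the prime-to-[p] part of
    [b], [N] is a power of [p] whose exponent is prescribed modulo [alpha].
    Conversely [Phi_(p^c)(1) = p] and [P(1) = b], so at most [alpha] exponents
    [c > 0] satisfy [Phi_(p^c) | P]. *)
Require Import Defs.
From HB Require Import structures.
From mathcomp Require Import all_boot all_order all_algebra.
From mathcomp Require Import cyclotomic algC qpoly.
From mathcomp Require Import complex.
From mathcomp Require Import zify ring lra.
From mathcomp Require Import finmap.
From mathcomp Require Import all_classical all_reals all_analysis.

Set Implicit Arguments.
Unset Strict Implicit.
Unset Printing Implicit Defensive.

Import Order.TTheory GRing.Theory Num.Theory.
Import numFieldNormedType.Exports.

Local Open Scope classical_set_scope.
Local Open Scope ring_scope.

(** * Cyclotomic polynomials *)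

Lemma map_intr_Cyclotomic (F : fieldType) n (z : F) :
  n.-primitive_root z -> map_poly intr 'Phi_n = cyclotomic z n.
Proof.
elim/ltn_ind: n z => n IHn z prim_z; have n_gt0 := prim_order_gt0 prim_z.
have n_dvd : n \in divisors n by rewrite -dvdn_divisors.
pose q := \prod_(d <- rem n (divisors n)) map_poly intr 'Phi_d : {poly F}.
have monic_q : q \is monic.
  by apply: monic_prod => d _; rewrite monic_map ?Cyclotomic_monic.
apply: (mulIf (monic_neq0 monic_q)).
transitivity ('X^n - 1 : {poly F}).
  rewrite -(map_polyXn intr n) -(rmorph1 (map_poly intr)) -rmorphB.
  by rewrite -prod_Cyclotomic // (big_rem n) //= rmorphM rmorph_prod.
rewrite (prod_cyclotomic prim_z) (big_rem n) //= divnn n_gt0 expr1.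
congr (_ * _); apply: eq_big_seq => d.
rewrite mem_rem_uniq ?divisors_uniq // inE -dvdn_divisors //.
move=> /andP[d_neq_n d_dvd_n].
by rewrite -IHn ?dvdn_prim_root // ltn_neqAle d_neq_n dvdn_leq.
Qed.

Lemma map_ratr_intr (F : numFieldType) (P : {poly int}) :
  map_poly ratr (map_poly intr P) = map_poly intr P :> {poly F}.
Proof.
by rewrite -map_poly_comp; apply: eq_map_poly => c /=; rewrite ratr_int.
Qed.

Lemma irreducible_Cyclotomic n : (0 < n)%N ->
  irreducible_poly (map_poly intr 'Phi_n : {poly rat}).
Proof.
move=> n_gt0; have [z prim_z] := C_prim_root_exists n_gt0.
have map_Phi :
    map_poly ratr (map_poly intr 'Phi_n : {poly rat}) = cyclotomic z n.
  by rewrite map_ratr_intr (map_intr_Cyclotomic prim_z).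
split=> [|q size_q /dvdpP[q' Phi_eq]].
  rewrite -(size_map_poly (ratr : {rmorphism rat -> algC})) /= map_Phi.
  by rewrite size_cyclotomic ltnS totient_gt0.
have [w qw] : exists w : algC, root (map_poly ratr q) w.
  by apply/closed_rootP; rewrite size_map_poly.
have prim_w : n.-primitive_root w.
  by rewrite -(root_cyclotomic prim_z) -map_Phi Phi_eq rmorphM rootM qw orbT.
rewrite /eqp {1}Phi_eq dvdp_mulIr /=.
have [m [m_eq _] m_dvd] := minCpolyP w.
suff <- : m = map_poly intr 'Phi_n by rewrite -m_dvd.
apply: (map_poly_inj (ratr : {rmorphism rat -> algC})); rewrite /= -m_eq.
rewrite (minCpoly_cyclotomic prim_w).
by rewrite map_ratr_intr (map_intr_Cyclotomic prim_w).
Qed.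

Lemma dvdp_Cyclotomic_root (F : numFieldType) n (z : F) (P : {poly int}) :
  n.-primitive_root z -> ('Phi_n %| P) = root (map_poly intr P) z.
Proof.
move=> prim_z; have n_gt0 := prim_order_gt0 prim_z.
have Phi_z : root (map_poly intr 'Phi_n) z.
  by rewrite (map_intr_Cyclotomic prim_z) root_cyclotomic.
rewrite -dvdp_rat_int; apply/idP/idP => [/dvdpP[Q Phi_dvd]|].
  by rewrite -map_ratr_intr Phi_dvd rmorphM rootM /= map_ratr_intr Phi_z orbT.
apply: contraLR.
rewrite -(irreducible_poly_coprime _ (irreducible_Cyclotomic n_gt0)).
rewrite -(coprimep_map (ratr : {rmorphism rat -> F})) /= !map_ratr_intr.
by move=> /coprimep_root; apply.
Qed.

Lemma dvdp_Cyclotomic_eq m n :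
  (0 < m)%N -> (0 < n)%N -> ('Phi_m %| 'Phi_n) = (m == n).
Proof.
move=> m_gt0 n_gt0; apply/idP/eqP => [|-> //].
have [z prim_z] := C_prim_root_exists m_gt0.
have [w prim_w] := C_prim_root_exists n_gt0.
rewrite (dvdp_Cyclotomic_root _ prim_z) (map_intr_Cyclotomic prim_w).
rewrite (root_cyclotomic prim_w) => prim_z'; apply/eqP; rewrite eqn_dvd.
rewrite (prim_order_dvd prim_z) (prim_order_dvd prim_z').
by rewrite !prim_expr_order ?eqxx.
Qed.

Lemma dvdp_prod_Cyclotomic (ns : seq nat) (P : {poly int}) :
  uniq ns -> {in ns, forall n, (0 < n)%N && ('Phi_n %| P)} ->
  exists Q, P = Q * \prod_(n <- ns) 'Phi_n.
Proof.
elim: ns P => [|n ns IHns] P; first by exists P; rewrite big_nil mulr1.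
move=> /andP[n_notin uniq_ns] ns_dvd.
have /andP[n_gt0 /dvd_CyclotomicP[P' P_eq]] := ns_dvd n (mem_head _ _).
have [d d_in|Q P'_eq] := IHns P' uniq_ns; last first.
  by exists Q; rewrite P_eq P'_eq big_cons [in RHS]mulrCA mulrC.
have /andP[d_gt0] : (0 < d)%N && ('Phi_d %| P).
  by rewrite ns_dvd // inE d_in orbT.
have [z prim_z] := C_prim_root_exists d_gt0.
rewrite d_gt0 !(dvdp_Cyclotomic_root _ prim_z) P_eq rmorphM rootM.
case/orP=> //=; rewrite -(dvdp_Cyclotomic_root 'Phi_n prim_z).
by rewrite dvdp_Cyclotomic_eq // => /eqP d_eq; rewrite -d_eq d_in in n_notin.
Qed.

Lemma Cyclotomic_primeX p c : prime p ->
  'Phi_(p ^ c.+1) = \sum_(i < p) 'X^(p ^ c) ^+ i.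
Proof.
move=> p_prime; have pX_gt0 e : (0 < p ^ e)%N by rewrite expn_gt0 prime_gt0.
have divisors_pX :
    perm_eq (divisors (p ^ c.+1)) (p ^ c.+1 :: divisors (p ^ c))%N.
  apply: uniq_perm; rewrite ?cons_uniq ?divisors_uniq //.
    by rewrite -dvdn_divisors // dvdn_Pexp2l ?prime_gt1 // ltnn.
  move=> d; rewrite inE -!dvdn_divisors //.
  apply/(dvdn_pfactor _ _ p_prime)/predU1P => [[e]|[->|]].
  - rewrite leq_eqVlt ltnS => /predU1P[->|e_le] ->; first by left.
    by right; apply: dvdn_exp2l.
  - by exists c.+1.
  by move=> /(dvdn_pfactor _ _ p_prime)[e e_le ->]; exists e => //; apply: leqW.
have Xpc_neq0 : 'X^(p ^ c) - 1 != 0 :> {poly int}.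
  by rewrite monic_neq0 // monicXnsubC.
apply: (mulfI Xpc_neq0); rewrite -subrX1 -exprM -expnSr -!prod_Cyclotomic //.
by rewrite (perm_big _ divisors_pX) big_cons mulrC.
Qed.

Lemma horner1_Cyclotomic_primeX p c : prime p -> ('Phi_(p ^ c.+1)).[1] = p%:R.
Proof.
move=> p_prime; rewrite Cyclotomic_primeX // horner_sum.
under eq_bigr do rewrite hornerE hornerXn !expr1n.
by rewrite sumr_const card_ord.
Qed.

Lemma horner1_dvd_primeX p (cs : seq nat) (P : {poly int}) :
  prime p -> uniq cs -> {in cs, forall c, (0 < c)%N && ('Phi_(p ^ c) %| P)} ->
  ((p ^ size cs)%:Z %| P.[1])%Z.
Proof.
move=> p_prime uniq_cs cs_dvd.
have pX_inj : injective (expn p).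
  by move=> c d /eqP; rewrite eqn_exp2l ?prime_gt1 // => /eqP.
have [|n /mapP[c c_in ->]|Q ->] := @dvdp_prod_Cyclotomic (map (expn p) cs) P.
- by rewrite map_inj_uniq.
- by have /andP[_ ->] := cs_dvd c c_in; rewrite expn_gt0 prime_gt0.
rewrite hornerM big_map horner_prod (eq_big_seq (fun _ => p%:R)) => [|c c_in].
  by rewrite big_const_seq count_predT iter_mulr_1 -natrX natz dvdz_mull.
by have /andP[/prednK <- _] := cs_dvd c c_in; rewrite horner1_Cyclotomic_primeX.
Qed.

(** * Digit sums and the attractor *)

Fixpoint digit_sums (b : nat) (D : seq nat) (n : nat) : seq nat :=
  if n is m.+1 then [seq (d + b * u)%N | d <- D, u <- digit_sums b D m]
  else [:: 0%N].

Lemma size_digit_sums b D n : size (digit_sums b D n) = (size D ^ n)%N.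
Proof. by elim: n => //= n IHn; rewrite size_allpairs IHn expnS. Qed.

Lemma digit_sums_add b D m n :
  {subset digit_sums b D (m + n) <=
    [seq (u + b ^ m * v)%N | u <- digit_sums b D m, v <- digit_sums b D n]}.
Proof.
elim: m => [|m IHm] w.
  move=> w_in; apply/allpairsP; exists (0%N, w).
  by rewrite /= mem_seq1 add0n mul1n.
move=> /allpairsP[[d x] /= [d_in /IHm/allpairsP[[u v] /= [u_in v_in ->]] ->]].
apply/allpairsP; exists ((d + b * u)%N, v).
split=> //=; first exact: allpairs_f.
by rewrite mulnDr mulnA -expnS addnA.
Qed.

Lemma size_undup_digit_sumsM b D k n :
  (size (undup (digit_sums b D (k * n))) <=
   size (undup (digit_sums b D k)) ^ n)%N.
Proof.
elim: n => [|n IHn]; first by rewrite muln0.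
rewrite mulnS expnS (leq_trans _ (leq_mul (leqnn _) IHn)) //.
rewrite -(size_allpairs (fun u v => u + b ^ k * v)%N).
apply: uniq_leq_size (undup_uniq _) _ => w; rewrite mem_undup.
move=> /digit_sums_add/allpairsP[[u v] /= [u_in v_in ->]].
by apply: allpairs_f; rewrite mem_undup.
Qed.

Lemma digit_sums_le b D A n u : (1 < b)%N -> {in D, forall d, d <= A}%N ->
  u \in digit_sums b D n -> (u + A <= A * b ^ n)%N.
Proof.
move=> b_gt1 D_le; elim: n u => [|n IHn] u.
  by rewrite mem_seq1 => /eqP ->; lia.
move=> /allpairsP[[d v] /= [/D_le d_le /IHn v_le ->]].
have : (b * (v + A) <= A * b ^ n.+1)%N.
  by rewrite expnS mulnCA leq_mul2l v_le orbT.
by apply: leq_trans; nia.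
Qed.

Section Attractor.
Context (R : realType) (b : nat) (D : {fset nat}).
Hypothesis b_gt1 : (1 < b)%N.
Local Notation T := (digit_attractor b D : set R).

Let b_gt0 : 0 < b%:R :> R. Proof. by rewrite ltr0n ltnW. Qed.

Lemma digit_attractor_shift (x : R) : T x ->
  exists2 d, d \in D & T (b%:R * x - d%:R).
Proof.
move=> [d [d_in x_lim]]; exists (d 0%N) => //.
exists (d \o succn); split=> [k|]; first exact: d_in.
pose expansion (c : nat -> nat) : R^nat :=
  series (fun k => b%:R ^- k.+1 * (c k)%:R).
rewrite -/(expansion (d \o succn)).
have -> : expansion (d \o succn) =
    [sequence b%:R * expansion d n.+1 - (d 0%N)%:R]_n.
  apply/funext => n; rewrite /expansion /= !seriesEnat /= big_nat_recl //.
  rewrite mulrDr mulVKf ?gt_eqF //.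
  rewrite addrAC subrr add0r mulr_sumr; apply: eq_bigr => k _.
  by rewrite [b%:R ^+ k.+2]exprS invfM !mulrA mulfV ?gt_eqF // mul1r.
apply: cvgB; last exact: cvg_cst.
by apply: cvgMl_tmp; rewrite cvg_shiftS.
Qed.

Lemma digit_attractor_itv (A : nat) (x : R) :
  {in D, forall d, d <= A}%N -> T x -> 0 <= x <= A%:R.
Proof.
move=> D_le [d [d_in x_lim]]; apply/andP; split.
  apply: (cvgr_to_ge x_lim); apply: nearW => n.
  by rewrite seriesEnat; apply: sumr_ge0.
apply: (cvgr_to_le x_lim); apply: nearW => n; rewrite seriesEnat /=.
pose tail k : R := - (A%:R * b%:R ^- k).
apply: (@le_trans _ _ (\sum_(0 <= k < n) (tail k.+1 - tail k))); last first.
  by rewrite telescope_sumr // /tail expr0 invr1 mulr1 opprK gerDr oppr_le0.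
apply: ler_sum => k _; rewrite /tail opprK addrC lerBrDr mulrC -mulrDl.
have -> : b%:R ^- k = b%:R * b%:R ^- k.+1 :> R.
  by rewrite exprS invfM mulVKf ?gt_eqF.
rewrite mulrA ler_wpM2r // -natrD -natrM ler_nat.
by have := D_le _ (d_in k); nia.
Qed.

Lemma digit_sums_cover A n (x : R) : {in D, forall d, d <= A}%N -> T x ->
  exists2 u, u \in digit_sums b D n & 0 <= b%:R ^+ n * x - u%:R <= A%:R.
Proof.
move=> D_le Tx; suff [u u_in Tu] : exists2 u, u \in digit_sums b D n &
    T (b%:R ^+ n * x - u%:R) by exists u => //; apply: digit_attractor_itv.
elim: n => [|n [u u_in /digit_attractor_shift[d d_in Td]]].
  by exists 0%N; rewrite ?mem_seq1 // mul1r subr0.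
exists (d + b * u)%N; first exact: allpairs_f.
by move: Td; rewrite mulrBr mulrA -exprS natrD natrM opprD addrA addrAC.
Qed.

(* The points are more than [A * b^-n] apart, so no two of them lie in the same
   copy of the attractor. *)
Lemma size_undup_digit_sums_ge (A n N : nat) (x : R) :
  {in D, forall d, d <= A}%N ->
  (forall j : 'I_N, T (x + j%:R * (A.+1%:R / b%:R ^+ n))) ->
  (N <= size (undup (digit_sums b D n)))%N.
Proof.
move=> D_le Tx.
have [u u_in u_near] :=
  fin_all_exists2 (fun j => digit_sums_cover n D_le (Tx j)).
have u_gap (i j : 'I_N) : u i = u j -> (i <= j)%N.
  move=> u_eq; rewrite leqNgt; apply/negP => lt_ji.
  have : (j%:R + 1 <= i%:R :> R) by rewrite natr1 ler_nat.
  rewrite -(@ler_pM2r _ A.+1%:R) ?ltr0n // mulrDl mul1r -(natr1 A) => gap.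
  have scale (l : 'I_N) : b%:R ^+ n * (x + l%:R * (A.+1%:R / b%:R ^+ n)) =
      b%:R ^+ n * x + l%:R * (A%:R + 1) :> R.
    by rewrite mulrDr natr1; congr (_ + _); field; rewrite gt_eqF // exprn_gt0.
  by have := u_near i; have := u_near j; rewrite !scale u_eq; lra.
have u_inj : injective u.
  by move=> i j u_eq; apply/val_inj/anti_leq; rewrite !u_gap.
rewrite -[N]card_ord -(size_codom u); apply: uniq_leq_size.
  exact/injectiveP.
by move=> _ /codomP[j ->]; rewrite mem_undup.
Qed.

Lemma expn_le_size_undup_digit_sums : interior T !=set0 ->
  exists c, forall n, (b ^ n <= c * size (undup (digit_sums b D n)))%N.
Proof.
move=> [x [e /= e_gt0 ball_sub]]; pose A := (\max_(d <- D) d)%N.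
have D_le : {in D, forall d, d <= A}%N.
  by move=> d d_in; apply: (leq_bigmax_seq (F := id)).
have [c A_lt] : exists c : nat, A.+1%:R < e * c%:R.
  exists (Num.bound (A.+1%:R / e)).
  by rewrite mulrC -ltr_pdivrMr // archi_boundP // divr_ge0 // ltW.
exists c => n; set N := size _.
rewrite leqNgt; apply/negP => lt_cN; suff: (N < N)%N by rewrite ltnn.
apply: (@size_undup_digit_sums_ge A n N.+1 x D_le) => j; apply: ball_sub.
have bn_gt0 : 0 < b%:R ^+ n :> R by rewrite exprn_gt0.
rewrite /ball /= opprD addNKr normrN ger0_norm // mulrA ltr_pdivrMr //.
apply: (@le_lt_trans _ _ (N%:R * (e * c%:R))).
  by apply: ler_pM => //; [rewrite ler_nat -ltnS | exact: ltW].
by rewrite mulrCA ltr_pM2l // -natrX -natrM ltr_nat mulnC.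
Qed.

End Attractor.

Lemma expn_dominates c a : exists n, (c * a ^ n < a.+1 ^ n)%N.
Proof.
have bernoulli n : (a ^ n * (a + n.+1) <= a.+1 ^ n.+1)%N.
  elim: n => [|n IHn]; first by rewrite mul1n addn1.
  rewrite [leqRHS]expnS; apply: leq_trans (leq_mul (leqnn a.+1) IHn).
  by rewrite expnSr -mulnA [leqRHS]mulnCA leq_mul2l; nia.
exists (c * a).+1; apply: leq_trans (bernoulli _).
by rewrite expnS mulnA mulnC ltn_pmul2l ?expn_gt0; lia.
Qed.

(* A collision at level [k] would leave at most [(b^k - 1)^n] sums at level
   [k * n], which is eventually less than [b^(k * n) / c]. *)
Lemma digit_sums_uniq (R : realType) b (D : {fset nat}) k : (1 < b)%N ->
  tile_digit_set R b D -> uniq (digit_sums b D k).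
Proof.
move=> b_gt1 [card_D /(expn_le_size_undup_digit_sums b_gt1)[c c_le]].
apply/negPn/negP => not_uniq.
have bk_gt0 : (0 < b ^ k)%N by rewrite expn_gt0 ltnW.
have undup_lt : (size (undup (digit_sums b D k)) <= (b ^ k).-1)%N.
  by rewrite -ltnS prednK // -{2}card_D -(size_digit_sums b) ltn_size_undup.
have [n] := expn_dominates c (b ^ k).-1.
rewrite prednK // -expnM ltnNge => /negP; apply.
apply: leq_trans (c_le _) _; rewrite leq_mul2l.
rewrite (leq_trans (size_undup_digit_sumsM _ _ _ _)) ?orbT //.
by case: n => // n; rewrite leq_exp2r.
Qed.

(** * Exponential sums at roots of unity *)

Definition expsum (A : nzRingType) (s : seq nat) (z : A) : A :=
  \sum_(x <- s) z ^+ x.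

Lemma expsum1 (A : nzRingType) s : expsum s (1 : A) = (size s)%:R.
Proof.
rewrite /expsum; under eq_bigr do rewrite expr1n.
by rewrite big_const_seq count_predT iter_addr_0.
Qed.

Lemma expsum_digit_sumsS (A : comNzRingType) b D n (z : A) :
  expsum (digit_sums b D n.+1) z =
  expsum D z * expsum (digit_sums b D n) (z ^+ b).
Proof.
rewrite /expsum big_allpairs_dep /= big_distrl /=; apply: eq_bigr => d _.
by rewrite big_distrr /=; apply: eq_bigr => u _; rewrite exprD exprM.
Qed.

Lemma horner_mask_poly (A : comNzRingType) (D : {fset nat}) (z : A) :
  (map_poly intr (mask_poly D)).[z] = expsum D z.
Proof.
rewrite /mask_poly rmorph_sum horner_sum; apply: eq_bigr => d _.
by rewrite /= map_polyXn hornerXn.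
Qed.

Lemma sum_unity_root (F : idomainType) n (w : F) : w ^+ n = 1 ->
  \sum_(t < n) w ^+ t = n%:R * (w == 1)%:R.
Proof.
move=> wn1; have [->|w_neq1] := eqVneq w 1.
  by under eq_bigr do rewrite expr1n; rewrite sumr_const card_ord mulr1.
apply: (mulfI (_ : w - 1 != 0)); first by rewrite subr_eq0.
by rewrite -subrX1 wn1 subrr !mulr0.
Qed.

Lemma norm_prim_root (F : numDomainType) n (z : F) :
  n.-primitive_root z -> `|z| = 1.
Proof.
move=> prim_z; apply/eqP.
rewrite -(@pexpr_eq1 _ _ n) ?(prim_order_gt0 prim_z) //.
by rewrite -normrX (prim_expr_order prim_z) normr1.
Qed.

Lemma parseval_prim_root (F : numClosedFieldType) n (z : F) (s : seq nat) :
  n.-primitive_root z ->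
  \sum_(t < n) `|expsum s (z ^+ t)| ^+ 2 =
  n%:R * \sum_(x <- s) \sum_(y <- s) (x == y %[mod n])%:R.
Proof.
move=> prim_z; have zx_neq0 x : z ^+ x != 0.
  by rewrite expf_neq0 // -normr_eq0 (norm_prim_root prim_z) oner_eq0.
have zJ : z^* = z^-1.
  by rewrite invC_norm (norm_prim_root prim_z) expr1n invr1 mul1r.
have normE t : `|expsum s (z ^+ t)| ^+ 2 =
    \sum_(x <- s) \sum_(y <- s) (z ^+ x / z ^+ y) ^+ t.
  rewrite normCK rmorph_sum big_distrl /=; apply: eq_bigr => x _.
  rewrite big_distrr; apply: eq_bigr => y _.
  by rewrite /= !rmorphXn /= zJ exprMn -!exprVn -!exprM ![(t * _)%N]mulnC.
under eq_bigr do rewrite normE.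
rewrite exchange_big mulr_sumr; apply: eq_bigr => x _.
rewrite exchange_big mulr_sumr; apply: eq_bigr => y _.
rewrite -(eq_prim_root_expr prim_z) sum_unity_root.
  by rewrite (can2_eq (divfK _) (mulfK _)) ?mul1r.
rewrite exprMn exprVn -!exprM ![(_ * n)%N]mulnC !exprM.
by rewrite (prim_expr_order prim_z) !expr1n divr1.
Qed.

Lemma sum_eqmod_le n A (s : seq nat) x : (0 < n)%N -> uniq s ->
  {in s, forall y, y < A * n}%N -> (\sum_(y <- s) (x == y %[mod n]) <= A)%N.
Proof.
move=> n_gt0 uniq_s s_lt.
have -> : (\sum_(y <- s) (x == y %[mod n]) =
    count (fun y => x == y %[mod n]) s)%N.
  by rewrite -sum1_count [RHS]big_mkcond.
rewrite -size_filter -(size_map (divn^~ n)) -[leqRHS](size_iota 0).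
apply: uniq_leq_size => [|_ /mapP[y + ->]].
  rewrite map_inj_in_uniq ?filter_uniq // => y y'.
  rewrite !mem_filter => /andP[/eqP y_mod _] /andP[/eqP y'_mod _] y_div.
  by rewrite (divn_eq y n) (divn_eq y' n) y_div -y_mod -y'_mod.
by rewrite mem_filter mem_iota add0n ltn_divLR // => /andP[_ /s_lt].
Qed.

Lemma bessel_prim_root (F : numClosedFieldType) n A (z : F) (s : seq nat) :
  n.-primitive_root z -> uniq s -> {in s, forall x, x < A * n}%N ->
  \sum_(t < n) `|expsum s (z ^+ t)| ^+ 2 <= (n * (A * size s))%:R.
Proof.
move=> prim_z uniq_s s_lt; rewrite (parseval_prim_root _ prim_z).
under eq_bigr do rewrite -natr_sum.
rewrite -natr_sum -natrM ler_nat leq_mul2l -sum1_size big_distrr /= muln1.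
rewrite leq_sum ?orbT // => x _.
by rewrite sum_eqmod_le ?(prim_order_gt0 prim_z).
Qed.

Lemma ler_sum_inj (F : numDomainType) (I J : finType)
    (f : I -> J) (G : J -> F) :
  injective f -> (forall j, 0 <= G j) -> \sum_i G (f i) <= \sum_j G j.
Proof.
move=> f_inj G_ge0; have -> : \sum_i G (f i) = \sum_(j in f @: I) G j.
  by rewrite big_imset //; apply: in2W.
by rewrite [leRHS](bigID [in f @: I]) lerDl sumr_ge0.
Qed.

Lemma ler_1Bsum_prod (F : numDomainType) (I : Type) (r : seq I)
    (P : pred I) (x : I -> F) :
  (forall i, P i -> 0 <= x i <= 1) ->
  1 - \sum_(i <- r | P i) x i <= \prod_(i <- r | P i) (1 - x i).
Proof.
move=> x01; have prod_le1 (s : seq I) : \prod_(i <- s | P i) (1 - x i) <= 1.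
  apply: prodr_ile1 => i /x01/andP[x_ge0 x_le1].
  by rewrite subr_ge0 x_le1 gerBl.
elim: r => [|i r IHr]; first by rewrite !big_nil subr0.
rewrite !big_cons; case: ifP => // /x01/andP[x_ge0 x_le1].
rewrite mulrBl mul1r opprD addrCA addrC lerB //.
by rewrite -[leRHS]mulr1 ler_wpM2l.
Qed.

Lemma prod_1Bexp_half_ge (F : numFieldType) n :
  2^-1 <= \prod_(k < n) (1 - 2^-1 ^+ k.+2) :> F.
Proof.
have half_ge0 : 0 <= 2^-1 :> F by rewrite invr_ge0 ler0n.
have half_le1 : 2^-1 <= 1 :> F by rewrite invf_le1 ?ltr0n // ler1n.
apply: le_trans (ler_1Bsum_prod _ _) => [|k _]; last first.
  by rewrite exprn_ge0 // exprn_ile1.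
have -> : \sum_(k < n) 2^-1 ^+ k.+2 = 2^-1 - 2^-1 ^+ n.+1 :> F.
  elim: n => [|n IHn]; first by rewrite big_ord0 subrr.
  by rewrite big_ord_recr /= IHn !exprS; field.
rewrite opprB addrCA -[leLHS]add0r lerD ?exprn_ge0 //.
by rewrite le_eqVlt; apply/orP; left; apply/eqP; field.
Qed.

(** * Kenyon's criterion *)

Section ComplexExponential.
Context (R : realType).
Implicit Types (x y : R).

Lemma norm_natmul_bounded_eq0 (z : R[i]) (c : nat) :
  (forall n, n%:R * `|z| ^+ 2 <= c%:R) -> z = 0.
Proof.
move=> bounded; apply/eqP; rewrite -normr_eq0 -sqrf_eq0 -add_Re2_Im2.
set r := _ + _; have r_ge0 : 0 <= r by rewrite addr_ge0 ?sqr_ge0.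
rewrite (inj_eq (@complexI R) r 0); apply: contraT => r_neq0.
have r_gt0 : 0 < r by rewrite lt_neqAle eq_sym r_neq0.
have := bounded (Num.bound (c%:R / r)); rewrite -add_Re2_Im2 -/r.
rewrite -(rmorph_nat (real_complex R)) -rmorphM.
rewrite -(rmorph_nat (real_complex R)) lecR.
by rewrite -ler_pdivlMr // leNgt archi_boundP // divr_ge0.
Qed.

Definition expi2pi x : R[i] := (cos (pi *+ 2 * x) +i* sin (pi *+ 2 * x))%C.

Lemma expi2pi0 : expi2pi 0 = 1.
Proof. by rewrite /expi2pi mulr0 cos0 sin0. Qed.

Lemma expi2pi1 : expi2pi 1 = 1.
Proof. by rewrite /expi2pi mulr1 cos2pi sin2pi. Qed.

Lemma expi2piD x y : expi2pi (x + y) = expi2pi x * expi2pi y.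
Proof. by rewrite /expi2pi mulrDr cosD sinD [_ + cos _ * sin _]addrC. Qed.

Lemma expi2piMn x n : expi2pi (x *+ n) = expi2pi x ^+ n.
Proof.
by elim: n => [|n IHn]; rewrite ?expi2pi0 // mulrS expi2piD IHn exprS.
Qed.

Lemma expi2pi_nat n : expi2pi n%:R = 1.
Proof. by rewrite expi2piMn expi2pi1 expr1n. Qed.

Lemma ler_norm_expi2piB1 x : 0 <= x -> `|expi2pi x - 1| <= (pi *+ 4 * x)%:C%C.
Proof.
move=> x_ge0; set t := pi *+ 2 * x.
have t_ge0 : 0 <= t by rewrite mulr_ge0 // mulrn_wge0 // pi_ge0.
have [c _] := MVT_segment t_ge0 (fun u _ => is_derive_sin u)
  (continuous_subspaceT (@continuous_sin R)).
have [c' _] := MVT_segment t_ge0 (fun u _ => is_derive_cos u)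
  (continuous_subspaceT (@continuous_cos R)).
rewrite sin0 cos0 !subr0 => cosE sinE.
have -> : expi2pi x - 1 = (cos t - 1)%:C%C + 'i%C * (sin t)%:C%C.
  by rewrite [LHS]complexE /= subr0.
apply: le_trans (ler_normD _ _) _.
rewrite normrM !normc_def /= !expr0n /= !addr0 add0r expr1n.
rewrite !sqrtr_sqr sqrtr1 mul1r.
have le_t (a : R) : `|a| <= 1 -> `|a * t| <= t.
  by move=> a_le1; rewrite normrM (ger0_norm t_ge0) ler_piMl.
rewrite -rmorphD lecR cosE sinE (le_trans (lerD (le_t _ _) (le_t _ _))) //.
- by rewrite normrN ler_norml sin_geN1 sin_le1.
- by rewrite ler_norml cos_geN1 cos_le1.
by rewrite /t -mulrDl -mulrnDr.
Qed.

Lemma expi2pi_prim_root n : (0 < n)%N -> n.-primitive_root (expi2pi n%:R^-1).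
Proof.
move=> n_gt0; have nR_gt0 : (0 : R) < n%:R by rewrite ltr0n.
apply/andP; split=> //; apply/forallP => i.
rewrite unity_rootE -expi2piMn; apply/eqP.
have [->|i_neq] := eqVneq i.+1 n.
  by rewrite -[_^-1 *+ n]mulr_natr (mulVf (lt0r_neq0 nR_gt0)) expi2pi1 eqxx.
apply/negbTE; rewrite eq_complex negb_and /=; apply/orP; left.
pose u : R := pi * (n%:R^-1 *+ i.+1).
have -> : pi *+ 2 * (n%:R^-1 *+ i.+1) = u *+ 2 :> R by rewrite mulrnAl.
have sin_gt0 : 0 < sin u.
  rewrite sin_gt0_pi // mulr_gt0 ?pi_gt0 ?pmulrn_lgt0 ?invr_gt0 //=.
  rewrite gtr_pMr ?pi_gt0 // -[_^-1 *+ _]mulr_natr mulrC ltr_pdivrMr //.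
  by rewrite mul1r ltr_nat ltn_neqAle i_neq ltn_ord.
rewrite cos_mulr2n cos2sin2 lt_eqF //.
by have := exprn_gt0 2 sin_gt0; lra.
Qed.

Lemma ler_norm_expsum_expi2pi (s : seq nat) x : 0 <= x ->
  (size s)%:R - (pi *+ 4 * (\sum_(d <- s) d)%:R * x)%:C%C <=
  `|expsum s (expi2pi x)|.
Proof.
move=> x_ge0; rewrite lerBlDr -lerBlDl -(normr_nat R[i] (size s)) -expsum1.
apply: le_trans (lerB_dist _ _) _; rewrite -sumrB.
apply: le_trans (ler_norm_sum _ _ _) _.
rewrite natr_sum mulr_sumr mulr_suml rmorph_sum; apply: ler_sum => d _.
rewrite distrC expr1n -expi2piMn -mulrA mulr_natl.
by apply: ler_norm_expi2piB1; rewrite mulrn_wge0.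
Qed.

End ComplexExponential.

Section Kenyon.
Context (R : realType) (b : nat) (D : seq nat).
Hypotheses (b_gt1 : (1 < b)%N) (size_D : size D = b).
Hypothesis uniq_sums : forall n, uniq (digit_sums b D n).
Local Notation e := (@expi2pi R).

Let b_gt0 : (0 < b)%N. Proof. exact: ltnW. Qed.
Let bX_gt0 n : 0 < b%:R ^+ n :> R. Proof. by rewrite exprn_gt0 // ltr0n. Qed.

Definition expsum_prod n (x : R) : R[i] :=
  \prod_(k < n) expsum D (e (x / b%:R ^+ k.+1)).

Lemma expsum_digit_sums_expi2pi n x :
  expsum (digit_sums b D n) (e (x / b%:R ^+ n)) = expsum_prod n x.
Proof.
elim: n => [|n IHn]; first by rewrite /expsum /expsum_prod big_seq1 big_ord0.
rewrite expsum_digit_sumsS -expi2piMn [RHS]big_ord_recr /=.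
rewrite -/(expsum_prod n x) -IHn mulrC; congr (expsum _ (e _) * _).
by rewrite -[LHS]mulr_natr exprSr invfM mulrA mulfVK // pnatr_eq0 -lt0n.
Qed.

Lemma expsum_prod_addl i n (m : nat) :
  expsum_prod (i + n) (m%:R * b%:R ^+ i) = b%:R ^+ i * expsum_prod n m%:R.
Proof.
rewrite /expsum_prod big_split_ord /=; congr (_ * _).
  rewrite -[X in _ = _ ^+ X]card_ord -prodr_const; apply: eq_bigr => k _.
  have -> : m%:R * b%:R ^+ i / b%:R ^+ k.+1 = (m * b ^ (i - k.+1))%:R :> R.
    rewrite natrM natrX -[X in _ * _ ^+ X / _](subnK (ltn_ord k)) exprD.
    by rewrite mulrA mulfK // gt_eqF.
  by rewrite expi2pi_nat expsum1 size_D.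
apply: eq_bigr => k _; congr (expsum _ (e _)).
by rewrite -addnS exprD; field; rewrite !gt_eqF.
Qed.

(* The factors of index [k >= K] are so close to [b] that their product is at
   least half the corresponding power of [b]. *)
Lemma norm_expsum_prod_addr : exists C : nat, forall (x : R) K n,
  0 <= x -> C%:R * x <= b%:R ^+ K ->
  `|expsum_prod K x| * b%:R ^+ n <= 2 * `|expsum_prod (K + n) x|.
Proof.
set c : R := pi *+ 4 * (\sum_(d <- D) d)%:R.
have c_ge0 : 0 <= c by rewrite mulr_ge0 // mulrn_wge0 // pi_ge0.
exists (Num.bound c) => x K n x_ge0 Cx_le.
have angle_le k : c * (x / b%:R ^+ (K + k).+1) <= 2^-1 ^+ k.+2 * b%:R.
  apply: (@le_trans _ _ (b%:R^-1 ^+ k.+1)).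
    rewrite exprVn -addnS exprD mulrA ler_pdivrMr ?mulr_gt0 // mulrCA.
    rewrite mulVf ?gt_eqF // mulr1; apply: le_trans Cx_le.
    by apply: ler_wpM2r => //; exact: ltW (archi_boundP c_ge0).
  apply: (@le_trans _ _ (2^-1 ^+ k.+1)).
    by rewrite ler_pXn2r ?nnegrE ?invr_ge0 // lef_pV2 ?posrE ?ltr0n // ler_nat.
  rewrite [_ ^+ k.+2]exprSr -mulrA ler_peMr ?exprn_ge0 ?invr_ge0 //.
  by rewrite ler_pdivlMl ?ltr0n // mulr1 ler_nat.
have factor_ge k : (1 - 2^-1 ^+ k.+2) * b%:R <=
    `|expsum D (e (x / b%:R ^+ (K + k).+1))|.
  have := ler_norm_expsum_expi2pi D (divr_ge0 x_ge0 (ltW (bX_gt0 (K + k).+1))).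
  rewrite -/c size_D; apply: le_trans; rewrite mulrBl mul1r lerB //.
  have -> : 2^-1 ^+ k.+2 * b%:R = (2^-1 ^+ k.+2 * b%:R)%:C%C :> R[i].
    by rewrite rmorphM rmorphXn fmorphV !rmorph_nat.
  by rewrite lecR.
rewrite {2}/expsum_prod big_split_ord normrM mulrCA ler_wpM2l //=.
rewrite -ler_pdivrMl ?ltr0n // normr_prod.
have -> : b%:R ^+ n = \prod_(k < n) b%:R :> R[i].
  by rewrite prodr_const card_ord.
apply: le_trans (ler_wpM2r _ (prod_1Bexp_half_ge _ n)) _.
  exact: prodr_ge0.
rewrite -big_split /=; apply: ler_prod => k _.
rewrite factor_ge andbT mulr_ge0 //.
by rewrite subr_ge0 exprn_ile1 ?invr_ge0 ?invf_le1 ?ltr0n ?ler0n ?ler1n.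
Qed.

Lemma norm_expsum_prod_mulX : exists C : nat, forall m K n i,
  (C * m <= b ^ K)%N -> (i <= n)%N ->
  `|expsum_prod K m%:R| * b%:R ^+ n <=
  2 * `|expsum_prod (K + n) (m * b ^ i)%:R|.
Proof.
have [C tail] := norm_expsum_prod_addr; exists C => m K n i Cm_le i_le_n.
have {}tail : `|expsum_prod K m%:R| * b%:R ^+ (n - i) <=
    2 * `|expsum_prod (K + (n - i)) m%:R|.
  by apply: tail; rewrite ?ler0n // -natrX -natrM ler_nat.
have -> : (K + n = i + (K + (n - i)))%N by lia.
rewrite natrM natrX expsum_prod_addl normrM normrX normr_nat.
rewrite -{1}(subnK i_le_n) exprD mulrA [leRHS]mulrCA [leRHS]mulrC.
by rewrite ler_wpM2r ?exprn_ge0 ?ler0n.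
Qed.

Lemma bessel_expsum_prod : exists A : nat, forall n,
  \sum_(t < b ^ n) `|expsum_prod n t%:R| ^+ 2 <= (A * (b ^ n) ^ 2)%:R.
Proof.
pose A := (\max_(d <- D) d).+1; exists A => n.
have D_le : {in D, forall d, d <= A}%N.
  by move=> d d_in; apply: leqW; apply: (leq_bigmax_seq (F := id)).
have bn_gt0 : (0 < b ^ n)%N by rewrite expn_gt0 b_gt0.
have prod_eq t :
    expsum_prod n t%:R = expsum (digit_sums b D n) (e (b ^ n)%:R^-1 ^+ t).
  by rewrite -expsum_digit_sums_expi2pi -expi2piMn mulr_natl natrX.
under eq_bigr do rewrite prod_eq.
have size_sums : size (digit_sums b D n) = (b ^ n)%N.
  by rewrite size_digit_sums size_D.
rewrite -mulnn mulnCA -[X in (_ * (_ * X))%N]size_sums.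
apply: bessel_prim_root (uniq_sums n) _; first exact: expi2pi_prim_root.
by move=> u /(digit_sums_le b_gt1 D_le); rewrite /A; lia.
Qed.

(* The [n] frequencies [m * b^i], [i < n], each contribute at least
   [(b^n / 2)^2] times the same constant to the sum bounded by Bessel's
   inequality, so this constant is 0. *)
Lemma expsum_prod_eq0 : exists C : nat, forall m K,
  (0 < m)%N -> (C * m <= b ^ K)%N -> expsum_prod K m%:R = 0.
Proof.
have [C lower] := norm_expsum_prod_mulX; have [A bessel] := bessel_expsum_prod.
exists (maxn C 2) => m K m_gt0 Cm_le; have m_lt : (m < b ^ K)%N by nia.
apply: (@norm_natmul_bounded_eq0 _ _ (4 * A * (b ^ K) ^ 2)) => n.
set r := `|expsum_prod K m%:R|.
have freq_lt (i : 'I_n) : (m * b ^ i < b ^ (K + n))%N.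
  by rewrite expnD ltn_mul // ltn_exp2l.
pose freq i : 'I_(b ^ (K + n)) := Ordinal (freq_lt i).
have freq_inj : injective freq.
  by move=> i j [/eqP]; rewrite eqn_pmul2l // eqn_exp2l // => /eqP/val_inj.
pose energy (t : 'I_(b ^ (K + n))) := `|expsum_prod (K + n) t%:R| ^+ 2.
have energy_ge i : r ^+ 2 * (b%:R ^+ n) ^+ 2 <= 4 * energy (freq i).
  have -> : 4 = 2 ^+ 2 :> R[i] by rewrite -natrX.
  rewrite -!exprMn ler_sqr ?nnegrE ?mulr_ge0 ?exprn_ge0 ?normr_ge0 ?ler0n //.
  by apply: lower; [nia | exact: ltnW].
have b2n_gt0 : 0 < (b%:R ^+ n) ^+ 2 :> R[i] by rewrite !exprn_gt0 // ltr0n.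
have sum_const : n%:R * r ^+ 2 * (b%:R ^+ n) ^+ 2 =
    \sum_(i < n) r ^+ 2 * (b%:R ^+ n) ^+ 2.
  by rewrite sumr_const card_ord -mulrA mulr_natl.
rewrite -(ler_pM2r b2n_gt0) sum_const.
apply: le_trans (ler_sum _ (fun i _ => energy_ge i)) _; rewrite -mulr_sumr.
have -> : (4 * A * (b ^ K) ^ 2)%:R * (b%:R ^+ n) ^+ 2 =
    4 * (A * (b ^ (K + n)) ^ 2)%:R :> R[i] by rewrite expnD !natrM !natrX; ring.
rewrite ler_wpM2l ?ler0n // (le_trans _ (bessel (K + n)%N)) //.
have energy_ge0 t : 0 <= energy t by rewrite exprn_ge0.
by have := ler_sum_inj freq_inj energy_ge0.
Qed.

End Kenyon.

Lemma Cyclotomic_dvd_mask_poly (R : realType) b (D : {fset nat}) :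
  (1 < b)%N -> tile_digit_set R b D -> exists C : nat, forall m K,
  (0 < m)%N -> (C * m <= b ^ K)%N ->
  exists2 k, (0 < k <= K)%N & 'Phi_(b ^ k %/ gcdn m (b ^ k)) %| mask_poly D.
Proof.
move=> b_gt1 tile_D; have [card_D _] := tile_D.
have uniq_sums n := digit_sums_uniq n b_gt1 tile_D.
have [C prod_eq0] := @expsum_prod_eq0 R b D b_gt1 card_D uniq_sums.
exists C => m K m_gt0 /(prod_eq0 _ _ m_gt0)/eqP.
rewrite prodf_seq_eq0 => /hasP[k _ /= /eqP root_k].
exists k.+1; first exact: ltn_ord.
have bk_gt0 : (0 < b ^ k.+1)%N by rewrite expn_gt0 ltnW.
rewrite (dvdp_Cyclotomic_root _ (exp_prim_root (expi2pi_prim_root R bk_gt0) m)).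
by rewrite /root horner_mask_poly -expi2piMn -[_ *+ m]mulr_natl natrX root_k.
Qed.

(** * The prime-power spectrum *)

Lemma horner1_mask_poly (D : {fset nat}) : (mask_poly D).[1] = (#|` D|%fset)%:R.
Proof.
have := horner_mask_poly D (1 : int).
by rewrite map_poly_id => [->|c _]; rewrite ?expsum1 ?intz.
Qed.

Lemma Cyclotomic1_dvd_mask_poly (D : {fset nat}) :
  ('Phi_1 %| mask_poly D) = (#|` D|%fset == 0)%N.
Proof.
have prim_1 : 1.-primitive_root (1 : rat).
  apply/andP; split=> //; apply/forallP => i.
  by rewrite ord1 unity_rootE expr1 !eqxx.
rewrite (dvdp_Cyclotomic_root _ prim_1) /root horner_mask_poly.
by rewrite expsum1 pnatr_eq0.
Qed.

Lemma size_Cyclotomic_primeX_le (D : {fset nat}) p (cs : seq nat) : prime p ->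
  (0 < #|` D|%fset)%N -> uniq cs ->
  {in cs, forall c, 'Phi_(p ^ c) %| mask_poly D} ->
  (size cs <= logn p #|` D|%fset)%N.
Proof.
move=> p_prime D_gt0 uniq_cs cs_dvd; rewrite -pfactor_dvdn //.
suff: ((p ^ size cs)%:Z %| (mask_poly D).[1])%Z.
  by rewrite horner1_mask_poly natz.
apply: horner1_dvd_primeX => // c c_in; rewrite cs_dvd // andbT lt0n.
apply: contraTneq D_gt0 => c0; rewrite -eqn0Ngt -Cyclotomic1_dvd_mask_poly.
by rewrite -(expn0 p) -c0 cs_dvd.
Qed.

Lemma divn_gcdn_primeX a p k K s t : coprime p a -> (0 < p)%N -> (0 < a)%N ->
  (k <= K)%N -> (s <= t)%N ->
  (a ^ k * p ^ t %/ gcdn (a ^ K * p ^ s) (a ^ k * p ^ t) = p ^ (t - s))%N.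
Proof.
move=> co_pa p_gt0 a_gt0 k_le s_le.
have -> : (a ^ K * p ^ s = a ^ k * p ^ s * a ^ (K - k))%N.
  by rewrite -{1}(subnKC k_le) expnD mulnAC.
have -> : (a ^ k * p ^ t = a ^ k * p ^ s * p ^ (t - s))%N.
  by rewrite -{1}(subnKC s_le) expnD mulnA.
have co_ap : coprime (a ^ (K - k)) (p ^ (t - s)).
  by rewrite coprimeXl // coprimeXr // coprime_sym.
by rewrite -muln_gcdr (eqP co_ap) muln1 mulKn // muln_gt0 !expn_gt0 a_gt0 p_gt0.
Qed.

(* Take [m = (b / p^alpha)^K * p^(alpha - l)]: for [0 < k <= K] the reduced
   denominator of [m / b^k] is [p^(alpha * (k - 1) + l)]. *)
Lemma Cyclotomic_primeX_dvd_mask_poly (R : realType) b (D : {fset nat}) p l :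
  (1 < b)%N -> tile_digit_set R b D -> prime p -> (l < logn p b)%N ->
  exists2 c, (c = l %[mod logn p b])%N & 'Phi_(p ^ c) %| mask_poly D.
Proof.
move=> b_gt1 tile_D p_prime; set alpha := logn p b => l_lt.
have [a co_pa b_eq] := pfactor_coprime p_prime (ltnW b_gt1).
rewrite -/alpha in b_eq.
have p_gt1 := prime_gt1 p_prime; have p_gt0 := ltnW p_gt1.
have a_gt0 : (0 < a)%N by case: a b_eq b_gt1 {co_pa} => // ->.
have [C kenyon] := Cyclotomic_dvd_mask_poly b_gt1 tile_D.
pose s := (alpha - l)%N; pose K := (C + s)%N.
have [| |k /andP[k_gt0 k_le]] := kenyon (a ^ K * p ^ s)%N K.
- by rewrite muln_gt0 !expn_gt0 a_gt0 p_gt0.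
- have C_le : (C * p ^ s <= p ^ K)%N.
    by rewrite expnD leq_mul // ltnW // ltn_expl.
  rewrite b_eq expnMn mulnCA leq_pmul2l ?expn_gt0 ?a_gt0 // (leq_trans C_le) //.
  by rewrite -expnM leq_pexp2l // leq_pmull //; lia.
rewrite b_eq expnMn -expnM divn_gcdn_primeX // ?/s; last by nia.
exists (alpha * k - s)%N => //.
have -> : (alpha * k - s = k.-1 * alpha + l)%N by rewrite /s; nia.
by rewrite modnMDl.
Qed.

Lemma modn_inj_of_size_le (S : pred nat) n :
  (forall l, (l < n)%N -> exists2 c, (c = l %[mod n])%N & S c) ->
  (forall cs, uniq cs -> {in cs, forall c, S c} -> (size cs <= n)%N) ->
  {in S &, injective (modn^~ n)}.
Proof.
move=> S_onto S_size; have [->|n_gt0] := posnP n.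
  by move=> c d _ _; rewrite !modn0.
have /fin_all_exists2[f f_mod Sf] (l : 'I_n) :
    exists2 c, (c = l %[mod n])%N & S c by apply: S_onto.
have f_mod_small l : (f l %% n = l)%N by rewrite f_mod modn_small.
have f_inj : injective f.
  by move=> l l' f_eq; apply: val_inj; rewrite /= -f_mod_small f_eq f_mod_small.
have fK c : S c -> f (Ordinal (ltn_pmod c n_gt0)) = c.
  move=> Sc; apply/eqP; apply: contraT => c_neq.
  have c_notin : c \notin codom f.
    apply: contra c_neq => /codomP[l ->]; apply/eqP; congr (f _).
    by apply: val_inj; apply: f_mod_small.
  have := S_size (c :: codom f).
  rewrite /= c_notin size_codom card_ord ltnn; apply; first exact/injectiveP.
  by move=> _ /predU1P[->//|/codomP[l ->]].
move=> c d Sc Sd cd_mod; rewrite -(fK c Sc) -(fK d Sd).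
by congr (f _); apply: val_inj.
Qed.

Lemma exists_unique_Cyclotomic_primeX (R : realType) b (D : {fset nat}) p l :
  (1 < b)%N -> tile_digit_set R b D -> prime p -> (p %| b)%N ->
  exists! c, (c = l %[mod logn p b])%N /\ 'Phi_(p ^ c) %| mask_poly D.
Proof.
move=> b_gt1 tile_D p_prime p_dvd; have [card_D _] := tile_D.
have Phi_onto l' (l'_lt : (l' < logn p b)%N) :=
  Cyclotomic_primeX_dvd_mask_poly b_gt1 tile_D p_prime l'_lt.
have Phi_size cs : uniq cs -> {in cs, forall c, 'Phi_(p ^ c) %| mask_poly D} ->
    (size cs <= logn p b)%N.
  move=> uniq_cs; rewrite -card_D.
  by apply: size_Cyclotomic_primeX_le; rewrite // card_D ltnW.
have alpha_gt0 : (0 < logn p b)%N by rewrite logn_gt0 mem_primes p_prime ltnW.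
have [c c_mod c_dvd] := Phi_onto _ (ltn_pmod l alpha_gt0).
rewrite modn_mod in c_mod.
exists c; split=> // d [d_mod d_dvd].
by apply: (modn_inj_of_size_le Phi_onto Phi_size) => //; rewrite c_mod d_mod.
Qed.

Lemma logn_prod (I : Type) (r : seq I) (P : pred I) (F : I -> nat) q :
  (forall i, P i -> 0 < F i)%N ->
  logn q (\prod_(i <- r | P i) F i) = (\sum_(i <- r | P i) logn q (F i))%N.
Proof.
move=> F_gt0; elim: r => [|i r IHr]; first by rewrite !big_nil logn1.
rewrite !big_cons; case: ifP => // Pi.
by rewrite lognM ?F_gt0 ?IHr // prodn_cond_gt0.
Qed.

Lemma logn_prod_primeX (I : finType) (p alpha : I -> nat) q :
  (forall i, prime (p i)) -> prime q ->
  logn q (\prod_i p i ^ alpha i) = (\sum_(i | p i == q) alpha i)%N.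
Proof.
move=> p_prime q_prime; rewrite logn_prod => [|i _]; last first.
  by rewrite expn_gt0 prime_gt0.
rewrite [RHS]big_mkcond; apply: eq_bigr => i _.
by rewrite lognX logn_prime // eq_sym; case: eqP; rewrite ?muln1 ?muln0.
Qed.

Lemma prime_dvd_prod_primeX (I : finType) (p alpha : I -> nat) q :
  (forall i, prime (p i)) -> prime q -> (q %| \prod_i p i ^ alpha i)%N ->
  exists i, q = p i.
Proof.
move=> p_prime q_prime; rewrite Euclid_dvd_prod // big_has => /hasP[i _ /=].
by rewrite Euclid_dvdX // dvdn_prime2 // => /andP[/eqP q_eq _]; exists i.
Qed.

Lemma prime_power_spectrumP (D : {fset nat}) q : (0 < #|` D|%fset)%N ->
  prime_power_spectrum D q <-> exists p c,
    [/\ prime p, (p %| #|` D|%fset)%N, q = (p ^ c)%N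
      & 'Phi_(p ^ c) %| mask_poly D].
Proof.
move=> D_gt0; split=> [[p [c [p_prime -> _ dvd]]]|[p [c [p_prime _ q_eq dvd]]]].
  exists p, c; split=> //.
  have : (size [:: c] <= logn p #|` D|%fset)%N.
    by apply: size_Cyclotomic_primeX_le => // d; rewrite inE => /eqP ->.
  by rewrite logn_gt0 mem_primes => /and3P[].
exists p, c; rewrite q_eq; split=> //.
rewrite ltn_neqAle expn_gt0 prime_gt0 // andbT.
apply: contraTneq D_gt0 => pc1; rewrite -eqn0Ngt -Cyclotomic1_dvd_mask_poly.
by rewrite pc1.
Qed.

Theorem theorem2p4 (R : realType) (b : nat) (hb : (1 < b)%N)
    (k : nat) (p alpha : 'I_k -> nat)
    (p_prime : forall j, prime (p j)) (p_inj : injective p)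
    (alpha_ge1 : forall j, (1 <= alpha j)%N)
    (b_fact : b = (\prod_(j < k) p j ^ alpha j)%N)
    (D : {fset nat}) (hD : tile_digit_set R b D) :
  exists a : 'I_k -> nat -> nat,
    (forall (j : 'I_k) (l : nat), (l < alpha j)%N ->
       unique (fun c : nat => (c = l %[mod alpha j])%N /\
                              'Phi_(p j ^ c) %| mask_poly D) (a j l)) /\
    prime_power_spectrum D =
      \bigcup_(j in [set: 'I_k]) [set (p j ^ a j l)%N | l in `I_(alpha j)].
Proof.
have card_D : #|` D|%fset = b by case: hD.
have D_gt0 : (0 < #|` D|%fset)%N by rewrite card_D ltnW.
have logn_b j : logn (p j) b = alpha j.
  by rewrite b_fact logn_prod_primeX // (big_pred1 j) // => i; rewrite inj_eq.
have p_dvd j : (p j %| b)%N.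
  by have := alpha_ge1 j; rewrite -logn_b logn_gt0 mem_primes => /and3P[].
have /choice[f fP] (jl : 'I_k * nat) : exists c,
    unique (fun c => (c = jl.2 %[mod alpha jl.1])%N /\
                     'Phi_(p jl.1 ^ c) %| mask_poly D) c.
  by rewrite -logn_b; apply: exists_unique_Cyclotomic_primeX hb hD _ _.
exists (fun j l => f (j, l)); split=> [j l _|]; first exact: (fP (j, l)).
apply/seteqP; split=> q /=.
  move=> /(prime_power_spectrumP _ D_gt0)[r [c [r_prime]]].
  rewrite card_D b_fact => /prime_dvd_prod_primeX[] // j -> -> c_dvd.
  exists j => //; exists (c %% alpha j)%N; first by rewrite /= ltn_mod.
  by rewrite ((fP (j, _)).2 c) ?modn_mod.
move=> [j _ [l _ <-]]; apply/prime_power_spectrumP => //.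
exists (p j), (f (j, l)); rewrite card_D.
by split=> //; case: (fP (j, l)) => -[].
Qed.
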